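(* Suppose $\hat K=\begin{bmatrix}K_1&\cdots&K_{n_s}\end{bmatrix}$ stabilizes the Markovian jump linear system $x_{t+1}=A_{\omega(t)}x_t+B_{\omega(t)}u_t$ in the mean square sense. Let $\hat K'$ be the one-step Gauss--Newton update $$\hat K'=\hat K-2\eta\begin{bmatrix}\psi_1L_1(\hat K)&\cdots&\psi_{n_s}L_{n_s}(\hat K)\end{bmatrix},\qquad \psi_i=\left(R_i+B_i^T\mathcal E_i(P^{\hat K})B_i\right)^{-1}.$$ If the step size satisfies $0<\eta\le\frac12$, then $\hat K'$ also stabilizes the system in the mean square sense.
   Context: Setting. In the Markovian jump linear system $x_{t+1}=A_{\omega(t)}x_t+B_{\omega(t)}u_t$, $t=0,1,2,\dots$, one has $x_t\in\mathbb R^d$, $u_t\in\mathbb R^k$, $A_i\in\mathbb R^{d\times d}$, $B_i\in\mathbb R^{d\times k}$ for $i\in\Omega=\{1,\dots,n_s\}$, and $\omega(t)$ is a Markov chain on $\Omega$ with transition probabilities $p_{ij}=\mathbb P(\omega(t+1)=j\mid\omega(t)=i)$. The matrices $Q_i\succ0$ ($d\times d$) and $R_i\succ0$ ($k\times k$) are given and symmetric. A policy $\hat K=\begin{bmatrix}K_1&\cdots&K_{n_s}\end{bmatrix}$, $K_i\in\mathbb R^{k\times d}$, acts by $u_t=-K_{\omega(t)}x_t$. It stabilizes the system in the mean square sense if the closed loop satisfies $\mathbb E[\|x_t\|^2]\to0$ for every initial state and every initial mode distribution. Notation. For a family $P=(P_j)_{j\in\Omega}$, $\mathcal E_i(P)=\sum_{j=1}^{n_s}p_{ij}P_j$.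 For a mean-square stabilizing $\hat K$, $P^{\hat K}=(P_i^{\hat K})_{i\in\Omega}$ is the solution of $P_i^{\hat K}=Q_i+K_i^TR_iK_i+(A_i-B_iK_i)^T\mathcal E_i(P^{\hat K})(A_i-B_iK_i)$, $i\in\Omega$, and $L_i(\hat K)=(R_i+B_i^T\mathcal E_i(P^{\hat K})B_i)K_i-B_i^T\mathcal E_i(P^{\hat K})A_i$. *)

(* Defs.v *)
From mathcomp Require Import all_boot all_order all_algebra.
From mathcomp Require Import all_classical all_reals all_analysis.
Import Order.TTheory GRing.Theory Num.Theory.
Import numFieldNormedType.Exports.

Set Implicit Arguments.
Unset Strict Implicit.
Unset Printing Implicit Defensive.

Local Open Scope classical_set_scope.
Local Open Scope ring_scope.

Definition posdef {R : realType} {m : nat} (M : 'M[R]_m) : Prop :=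
  M^T = M /\ forall v : 'cV[R]_m, v != 0 -> 0 < (v^T *m M *m v) 0 0.

(* The library norm on 'cV[R]_m is the sup norm, hence an explicit Euclidean
   norm. *)
Definition sqnorm {R : realType} {m : nat} (v : 'cV[R]_m) : R :=
  \sum_i v i 0 ^+ 2.

Definition distribution_on {R : realType} {n : nat} (mu : 'I_n -> R) : Prop :=
  (forall i, 0 <= mu i) /\ \sum_i mu i = 1.

(* The last conjunct says both that w (t+1) depends on the past only through
   w t and that P(w (t+1) = j | w t = i) = p i j. It is in product form, so
   that no conditioning on null events occurs. *)
Definition markov_chain {R : realType} {n : nat} {d : measure_display}
    {T : measurableType d} (Pr : probability T R) (w : nat -> T -> 'I_n)
    (mu : 'I_n -> R) (p : 'I_n -> 'I_n -> R) : Prop :=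
  [/\ forall t i, measurable (w t @^-1` [set i]),
      forall i, Pr [set z | w 0%N z = i] = (mu i)%:E
    & forall (t : nat) (h : nat -> 'I_n) (j : 'I_n),
        Pr [set z | (forall s, (s <= t)%N -> w s z = h s) /\ w t.+1 z = j] =
        (Pr [set z | forall s, (s <= t)%N -> w s z = h s] *
         (p (h t) j)%:E)%E].

(* A single chain w, together with one law Pr mu for each initial mode
   distribution mu; Pr is unconstrained at arguments that are not
   distributions. *)
Definition markov_family {R : realType} {n : nat} {d : measure_display}
    {T : measurableType d} (Pr : ('I_n -> R) -> probability T R)
    (w : nat -> T -> 'I_n) (p : 'I_n -> 'I_n -> R) : Prop :=
  forall mu, distribution_on mu -> markov_chain (Pr mu) w mu p.

(* Closed-loop state along a mode path, with u_t = - K_(w t) x_t. *)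
Fixpoint state {R : realType} {n d k : nat}
    (A : 'I_n -> 'M[R]_d) (B : 'I_n -> 'M[R]_(d, k)) (K : 'I_n -> 'M[R]_(k, d))
    (w : nat -> 'I_n) (x0 : 'cV[R]_d) (t : nat) : 'cV[R]_d :=
  if t is s.+1 then
    let x := state A B K w x0 s in
    let u := - (K (w s) *m x) in
    A (w s) *m x + B (w s) *m u
  else x0.

Definition ms_stabilizing {R : realType} {n d k : nat} {dT : measure_display}
    {T : measurableType dT} (Pr : ('I_n -> R) -> probability T R)
    (w : nat -> T -> 'I_n)
    (A : 'I_n -> 'M[R]_d) (B : 'I_n -> 'M[R]_(d, k))
    (K : 'I_n -> 'M[R]_(k, d)) : Prop :=
  forall (x0 : 'cV[R]_d) (mu : 'I_n -> R), distribution_on mu ->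
    ('E_(Pr mu)[fun z => sqnorm (state A B K (fun s => w s z) x0 t)])%E
      @[t --> \oo] --> 0%E.

Definition mode_avg {R : realType} {n d : nat} (p : 'I_n -> 'I_n -> R)
    (P : 'I_n -> 'M[R]_d) (i : 'I_n) : 'M[R]_d :=
  \sum_j p i j *: P j.

Definition coupled_lyapunov {R : realType} {n d k : nat}
    (p : 'I_n -> 'I_n -> R) (A : 'I_n -> 'M[R]_d) (B : 'I_n -> 'M[R]_(d, k))
    (Q : 'I_n -> 'M[R]_d) (Rc : 'I_n -> 'M[R]_k) (K : 'I_n -> 'M[R]_(k, d))
    (P : 'I_n -> 'M[R]_d) : Prop :=
  forall i, P i = Q i + (K i)^T *m Rc i *m K i
    + (A i - B i *m K i)^T *m mode_avg p P i *m (A i - B i *m K i).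

(* "The" solution of the coupled Lyapunov equations, which is unique when K
   is mean-square stabilizing; the value is 0 if there is no solution. *)
Definition lyap_sol {R : realType} {n d k : nat}
    (p : 'I_n -> 'I_n -> R) (A : 'I_n -> 'M[R]_d) (B : 'I_n -> 'M[R]_(d, k))
    (Q : 'I_n -> 'M[R]_d) (Rc : 'I_n -> 'M[R]_k) (K : 'I_n -> 'M[R]_(k, d)) :
    'I_n -> 'M[R]_d :=
  xget (fun=> 0) [set P | coupled_lyapunov p A B Q Rc K P].

Definition gain_hess {R : realType} {n d k : nat}
    (p : 'I_n -> 'I_n -> R) (A : 'I_n -> 'M[R]_d) (B : 'I_n -> 'M[R]_(d, k))
    (Q : 'I_n -> 'M[R]_d) (Rc : 'I_n -> 'M[R]_k) (K : 'I_n -> 'M[R]_(k, d))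
    (i : 'I_n) : 'M[R]_k :=
  Rc i + (B i)^T *m mode_avg p (lyap_sol p A B Q Rc K) i *m B i.

Definition gain_grad {R : realType} {n d k : nat}
    (p : 'I_n -> 'I_n -> R) (A : 'I_n -> 'M[R]_d) (B : 'I_n -> 'M[R]_(d, k))
    (Q : 'I_n -> 'M[R]_d) (Rc : 'I_n -> 'M[R]_k) (K : 'I_n -> 'M[R]_(k, d))
    (i : 'I_n) : 'M[R]_(k, d) :=
  gain_hess p A B Q Rc K i *m K i
    - (B i)^T *m mode_avg p (lyap_sol p A B Q Rc K) i *m A i.

Definition gauss_newton {R : realType} {n d k : nat}
    (p : 'I_n -> 'I_n -> R) (A : 'I_n -> 'M[R]_d) (B : 'I_n -> 'M[R]_(d, k))
    (Q : 'I_n -> 'M[R]_d) (Rc : 'I_n -> 'M[R]_k) (eta : R)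
    (K : 'I_n -> 'M[R]_(k, d)) : 'I_n -> 'M[R]_(k, d) :=
  fun i => K i - (2 * eta) *:
    (invmx (gain_hess p A B Q Rc K i) *m gain_grad p A B Q Rc K i).

(* Main.v *)
Require Import Defs.
From HB Require Import structures.
From mathcomp Require Import all_boot all_order all_algebra.
From mathcomp Require Import all_classical all_reals all_analysis.
From mathcomp Require Import ring lra.
Import Order.TTheory GRing.Theory Num.Theory.
Import numFieldNormedType.Exports.

Set Implicit Arguments.
Unset Strict Implicit.
Unset Printing Implicit Defensive.

Local Open Scope classical_set_scope.
Local Open Scope ring_scope.

(** Second moments of the closed loop are governed by a linear operator.  For a
    family [X] of matrices indexed by the modes, conditioning on the history of
    the chain up to time [t] gives
      E [x_(t+1)^T X_(w (t+1)) x_(t+1)] = E [x_t^T (S X)_(w t) x_t],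
      (S X)_i = F_i^T (sum_j p_ij X_j) F_i,   F_i = A_i - B_i K_i,
    so that E |x_t|^2 = sum_i mu_i x_0^T (S^t I)_i x_0 ([expectation_form]).
    Mean-square stability thus says exactly that the quadratic forms of [S^t I]
    tend to 0 ([ms_stabilizing_step_stable]), and the probability space is no
    longer needed.

    Let [K] be stabilizing.  As every family is bounded by a multiple of the
    identity, [S^t X] tends to 0 for each [X] ([step_stable_iter0]).  Hence [S]
    has no nonzero fixed point, and by finite dimension the coupled Lyapunov
    equations, which are affine with linear part [id - S], have exactly one
    solution [P] ([lyap_solP], [coupled_lyapunov_uniq]).  It is symmetric, and
    nonnegative because it dominates [S^t P], which tends to 0
    ([lyap_sol_ge0]).  So the matrices [H_i = R_i + B_i^T E_i(P) B_i] are
    positive definite.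

    Write the update as [K' = K - D].  Completing the square in the gain
    ([gauss_newton_cost]) shows that the one-step cost of [K'], with [P] as the
    cost to go, is [P_i - (1 / eta - 1) D_i^T H_i D_i <= P_i].  Hence the operator
    [S'] of the new closed loop satisfies [S' P <= P - Q]: the old value [P] is a
    Lyapunov function for the new loop.  By coercivity of [Q] this becomes
    [S' P <= r P] with [r < 1], and [I <= a P] for some [a], so the second moments
    decay geometrically ([lyapunov_step_stable]). *)

(** * Bilinear forms of matrices *)

Definition bilin {R : realType} {m : nat} (M : 'M[R]_m) (u v : 'cV[R]_m) : R :=
  (u^T *m M *m v) 0 0.

Lemma bilinE (R : realType) m (M : 'M[R]_m) u v :
  bilin M u v = \sum_i \sum_j u i 0 * M i j * v j 0.
Proof.
rewrite /bilin mxE exchange_big; apply: eq_bigr => j _.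
by rewrite mxE mulr_suml; apply: eq_bigr => i _; rewrite mxE.
Qed.

Lemma bilinD (R : realType) m (M N : 'M[R]_m) u v :
  bilin (M + N) u v = bilin M u v + bilin N u v.
Proof. by rewrite /bilin mulmxDr mulmxDl mxE. Qed.

Lemma bilinZ (R : realType) m a (M : 'M[R]_m) u v :
  bilin (a *: M) u v = a * bilin M u v.
Proof. by rewrite /bilin -scalemxAr -scalemxAl mxE. Qed.

Lemma bilin_sum (R : realType) m n (M : 'I_n -> 'M[R]_m) u v :
  bilin (\sum_i M i) u v = \sum_i bilin (M i) u v.
Proof. by rewrite /bilin mulmx_sumr mulmx_suml summxE. Qed.

Lemma bilin_congr (R : realType) m q (F : 'M[R]_(m, q)) (M : 'M[R]_m) u v :
  bilin (F^T *m M *m F) u v = bilin M (F *m u) (F *m v).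
Proof. by rewrite /bilin trmx_mul !mulmxA. Qed.

Lemma bilin_tr (R : realType) m (M : 'M[R]_m) u v :
  bilin M^T u v = bilin M v u.
Proof.
rewrite /bilin; suff -> : u^T *m M^T *m v = (v^T *m M *m u)^T by rewrite mxE.
by rewrite !trmx_mul trmxK mulmxA.
Qed.

Lemma bilin_sqrD (R : realType) m (M : 'M[R]_m) u v : M^T = M ->
  bilin M (u + v) (u + v) = bilin M u u + 2 * bilin M v u + bilin M v v.
Proof.
move=> MT; have uv : bilin M v u = bilin M u v by rewrite -bilin_tr MT.
move: uv; rewrite /bilin [(u + v)^T]linearD /= !(mulmxDl, mulmxDr) !mxE => ->; ring.
Qed.

Lemma bilin_sqrB (R : realType) m (M : 'M[R]_m) u v : M^T = M ->
  bilin M (u - v) (u - v) = bilin M u u - 2 * bilin M v u + bilin M v v.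
Proof.
move=> MT; rewrite bilin_sqrD// /bilin [(- v)^T]linearN /= !(mulNmx, mulmxN) opprK.
by rewrite [(- (v^T *m M *m u)) 0 0]mxE mulrN.
Qed.

Lemma bilin_inj (R : realType) m (M N : 'M[R]_m) :
  (forall u v, bilin M u v = bilin N u v) -> M = N.
Proof.
move=> MN; apply/matrixP => i j.
have entry (X : 'M[R]_m) : bilin X (delta_mx i 0) (delta_mx j 0) = X i j.
  by rewrite /bilin trmx_delta -rowE -colE !mxE.
by rewrite -!entry MN.
Qed.

Lemma sqnormE (R : realType) m (v : 'cV[R]_m) : sqnorm v = bilin 1%:M v v.
Proof.
by rewrite /bilin mulmx1 mxE; apply: eq_bigr => i _; rewrite mxE expr2.
Qed.

Lemma sqnorm_ge0 (R : realType) m (v : 'cV[R]_m) : 0 <= sqnorm v.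
Proof. by apply: sumr_ge0 => i _; rewrite sqr_ge0. Qed.

Lemma sqr_coord_le_sqnorm (R : realType) m (v : 'cV[R]_m) i :
  v i 0 ^+ 2 <= sqnorm v.
Proof.
rewrite /sqnorm (bigD1 i) //= lerDl.
by apply: sumr_ge0 => j _; rewrite sqr_ge0.
Qed.

(** Splitting the product of two coordinates by the inequality between the
    arithmetic and geometric means makes the bound additive in the two vectors,
    so that it survives averaging over modes and repeated congruences. *)
Lemma bilin_bounded (R : realType) m n (M : 'I_n -> 'M[R]_m) :
  exists2 C, 0 < C &
    forall i u v, `|bilin (M i) u v| <= C * (sqnorm u + sqnorm v).
Proof.
pose c i := \sum_a \sum_b `|M i a b|.
have c0 i : 0 <= c i.
  by apply: sumr_ge0 => a _; apply: sumr_ge0 => b _; rewrite normr_ge0.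
exists (1 + \sum_i c i); first by rewrite ltr_pwDl// sumr_ge0.
move=> i u v; apply: (@le_trans _ _ (c i * (sqnorm u + sqnorm v))); last first.
  apply: ler_wpM2r; first by rewrite addr_ge0 ?sqnorm_ge0.
  rewrite (bigD1 i) //= addrCA lerDl addr_ge0 //.
  by apply: sumr_ge0.
rewrite bilinE mulr_suml (le_trans (ler_norm_sum _ _ _))//.
apply: ler_sum => a _; rewrite mulr_suml (le_trans (ler_norm_sum _ _ _))//.
apply: ler_sum => b _; rewrite mulrAC normrM mulrC ler_wpM2l//.
rewrite normrM.
have := sqr_coord_le_sqnorm u a; have := sqr_coord_le_sqnorm v b.
rewrite -(real_normK (num_real (u a 0))) -(real_normK (num_real (v b 0))).
have := sqr_ge0 (`|u a 0| - `|v b 0|).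
have := sqr_ge0 (`|u a 0| + `|v b 0|).
nra.
Qed.

Lemma posdef_unit (R : realType) m (M : 'M[R]_m) : posdef M -> M \in unitmx.
Proof.
move=> [_ Mpos]; rewrite -row_free_unit -kermx_eq0.
apply/eqP/row_matrixP => i; rewrite row0; apply: contrapT => /eqP ri0.
have /Mpos : (row i (kermx M))^T != 0 by rewrite trmx_eq0.
by rewrite trmxK -row_mul mulmx_ker row0 mul0mx mxE ltxx.
Qed.

Lemma posdef_ge0 (R : realType) m (M : 'M[R]_m) v : posdef M -> 0 <= bilin M v v.
Proof.
move=> [_ Mpos]; have [->|/Mpos/ltW//] := eqVneq v 0.
by rewrite /bilin mulmx0 mxE.
Qed.

(** Coercivity, without a spectral theorem and without compactness: if
    [v^T M^-1 v <= c |v|^2], then expanding the form of [M] at the vector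
    [v - c^-1 M^-1 v] gives [0 <= v^T M v - c^-1 |v|^2]. *)
Lemma posdef_coercive (R : realType) m (M : 'M[R]_m) : posdef M ->
  exists2 C, 0 < C & forall v, sqnorm v <= C * bilin M v v.
Proof.
move=> Mpd; have Mu := posdef_unit Mpd; have [MT _] := Mpd.
have [C C0 Cb] := bilin_bounded (n := 1) (fun=> invmx M).
(* Twice [C], since [bilin_bounded] counts the square norm of both arguments. *)
exists (C *+ 2); first by rewrite mulrn_wgt0.
move=> v; set s := (C *+ 2)^-1.
have s0 : 0 < s by rewrite invr_gt0 mulrn_wgt0.
have := posdef_ge0 (v - s *: (invmx M *m v)) Mpd.
have -> : bilin M (v - s *: (invmx M *m v)) (v - s *: (invmx M *m v)) =
    bilin M v v - s *+ 2 * sqnorm v + s ^+ 2 * bilin (invmx M) v v.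
  have iMT : (invmx M)^T = invmx M by rewrite trmx_inv MT.
  have wM : (invmx M *m v)^T *m M = v^T by rewrite trmx_mul iMT mulmxKV.
  have Mw : M *m (invmx M *m v) = v by rewrite mulKVmx.
  rewrite sqnormE /bilin [(_ - _)^T]linearB /= [(s *: _)^T]linearZ /=.
  rewrite mulmxBl -scalemxAl wM mulmxBr mulmxBl -!scalemxAr mulmxBl.
  rewrite -!scalemxAl -[v^T *m M *m (_ *m v)]mulmxA Mw mulmx1 mulmxA.
  by rewrite !mxE; ring.
have := ler_norm (bilin (invmx M) v v); have := Cb ord0 v v.
have : s * (C *+ 2) = 1 by rewrite mulVf// gt_eqF// mulrn_wgt0.
have := sqnorm_ge0 v.
set q := bilin M v v; set r := bilin _ v v; set N := sqnorm v.
move=> N0 sC Nb rN H.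
have : s ^+ 2 * r <= s * N.
  have -> : s * N = s ^+ 2 * (C * (N + N)).
    by rewrite -[LHS]mul1r -[1]sC; ring.
  by rewrite ler_wpM2l ?sqr_ge0// (le_trans rN).
move=> H2.
have H3 : s * N <= q by rewrite -subr_ge0; move: H H2; lra.
rewrite -(ler_pM2l s0) mulrA sC mul1r //.
Qed.

(** * The second-moment operator *)

(** The adjoint of the map sending the family of second moments of the state,
    one for each mode, to that of the next step: the value of the form [X] at
    the next state and mode has conditional expectation [mode_step p F X i] at
    the current state, given the current mode [i]. *)
Definition mode_step {R : realType} {n d : nat} (p : 'I_n -> 'I_n -> R)
    (F X : 'I_n -> 'M[R]_d) (i : 'I_n) : 'M[R]_d :=
  (F i)^T *m mode_avg p X i *m F i.

Lemma bilin_mode_avg (R : realType) n d (p : 'I_n -> 'I_n -> R)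
    (X : 'I_n -> 'M[R]_d) i u v :
  bilin (mode_avg p X i) u v = \sum_j p i j * bilin (X j) u v.
Proof. by rewrite bilin_sum; apply: eq_bigr => j _; rewrite bilinZ. Qed.

Lemma bilin_mode_step (R : realType) n d (p : 'I_n -> 'I_n -> R)
    (F X : 'I_n -> 'M[R]_d) i u v :
  bilin (mode_step p F X i) u v = \sum_j p i j * bilin (X j) (F i *m u) (F i *m v).
Proof. by rewrite bilin_congr bilin_mode_avg. Qed.

Lemma tr_mode_step (R : realType) n d (p : 'I_n -> 'I_n -> R)
    (F X : 'I_n -> 'M[R]_d) i :
  (mode_step p F X i)^T = mode_step p F (fun j => (X j)^T) i.
Proof.
apply: bilin_inj => u v; rewrite bilin_tr !bilin_mode_step.
by apply: eq_bigr => j _; rewrite bilin_tr.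
Qed.

Lemma mode_step_linear (R : realType) n d (p : 'I_n -> 'I_n -> R)
    (F X Y : 'I_n -> 'M[R]_d) a i :
  mode_step p F (fun j => a *: X j + Y j) i =
  a *: mode_step p F X i + mode_step p F Y i.
Proof.
apply: bilin_inj => u v; rewrite bilinD bilinZ !bilin_mode_step mulr_sumr.
rewrite -big_split; apply: eq_bigr => j _ /=; rewrite bilinD bilinZ; ring.
Qed.

(** The operator-theoretic form of mean-square stability: it mentions neither
    the chain nor its law, only the transition weights. *)
Definition step_stable {R : realType} {n d : nat} (p : 'I_n -> 'I_n -> R)
    (F : 'I_n -> 'M[R]_d) : Prop :=
  forall i v, bilin (iter t (mode_step p F) (fun=> 1%:M) i) v v
    @[t --> \oo] --> (0 : R).

Section Positivity.
Variables (R : realType) (n d : nat) (p : 'I_n -> 'I_n -> R).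
Variable F : 'I_n -> 'M[R]_d.
Hypothesis p0 : forall i j, 0 <= p i j.

Lemma iter_mode_step_bounded (X : 'I_n -> 'M[R]_d) C :
  (forall i u v, `|bilin (X i) u v| <= C * (sqnorm u + sqnorm v)) ->
  forall t i u v, `|bilin (iter t (mode_step p F) X i) u v| <=
    C * (bilin (iter t (mode_step p F) (fun=> 1%:M) i) u u +
         bilin (iter t (mode_step p F) (fun=> 1%:M) i) v v).
Proof.
move=> XC; elim=> [|t IH] i u v; first by rewrite /= -!sqnormE.
rewrite !iterS !bilin_mode_step -big_split mulr_sumr.
rewrite (le_trans (ler_norm_sum _ _ _))//; apply: ler_sum => j _ /=.
rewrite normrM (ger0_norm (p0 i j)) -mulrDr mulrCA.
exact: ler_wpM2l (IH j _ _).
Qed.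

Lemma step_stable_iter0 (X : 'I_n -> 'M[R]_d) i u v : step_stable p F ->
  bilin (iter t (mode_step p F) X i) u v @[t --> \oo] --> (0 : R).
Proof.
move=> st; have [C C0 XC] := bilin_bounded X.
apply/norm_cvg0P; apply: (squeeze_cvgr (f := fun=> 0)
  (h := fun t => C * (bilin (iter t (mode_step p F) (fun=> 1%:M) i) u u +
                 bilin (iter t (mode_step p F) (fun=> 1%:M) i) v v))).
- by near=> t; rewrite normr_ge0 iter_mode_step_bounded.
- exact: cvg_cst.
- rewrite -(mulr0 C) -[X in C * X](addr0 0).
  by apply: cvgMr; apply: cvgD; apply: st.
Unshelve. all: by end_near. Qed.

Lemma step_fixed_eq0 (X : 'I_n -> 'M[R]_d) : step_stable p F ->
  (forall i, X i = mode_step p F X i) -> forall i, X i = 0.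
Proof.
move=> st /funext XE i; apply: bilin_inj => u v.
have Xt t : iter t (mode_step p F) X = X by elim: t => // t /= ->.
have := @step_stable_iter0 X i u v st.
under eq_fun do rewrite Xt.
move=> /(cvg_lim (@Rhausdorff R)); rewrite lim_cst// => ->.
by rewrite /bilin mulmx0 mul0mx mxE.
Qed.

Lemma mode_step_le (X Y : 'I_n -> 'M[R]_d) :
  (forall i v, bilin (X i) v v <= bilin (Y i) v v) ->
  forall i v, bilin (mode_step p F X i) v v <= bilin (mode_step p F Y i) v v.
Proof.
move=> XY i v; rewrite !bilin_mode_step; apply: ler_sum => j _.
exact: ler_wpM2l.
Qed.

Lemma mode_step_ge0 (X : 'I_n -> 'M[R]_d) :
  (forall i v, 0 <= bilin (X i) v v) ->
  forall i v, 0 <= bilin (mode_step p F X i) v v.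
Proof.
move=> X0 i v; rewrite bilin_mode_step; apply: sumr_ge0 => j _.
exact: mulr_ge0.
Qed.

(** A family dominating its own image dominates all iterates of it, which
    vanish in the limit. *)
Lemma supersolution_ge0 (P : 'I_n -> 'M[R]_d) : step_stable p F ->
  (forall i v, bilin (mode_step p F P i) v v <= bilin (P i) v v) ->
  forall i v, 0 <= bilin (P i) v v.
Proof.
move=> st PP i v.
have Pt t : forall i v,
    bilin (iter t (mode_step p F) P i) v v <= bilin (P i) v v.
  elim: t => // t IH j u; apply: le_trans (PP j u).
  exact: mode_step_le.
apply: (cvgr_to_le (@step_stable_iter0 P i v v st)).
by near=> t; apply: Pt.
Unshelve. all: by end_near. Qed.

(** A Lyapunov function that loses a fixed positive definite amount at each
    step loses a fixed fraction of itself, so that second moments decay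
    geometrically. *)
Lemma lyapunov_step_stable (P Q : 'I_n -> 'M[R]_d) :
  (forall i, posdef (Q i)) -> (forall i v, 0 <= bilin (P i) v v) ->
  (forall i v, bilin (mode_step p F P i) v v <=
     bilin (P i) v v - bilin (Q i) v v) ->
  step_stable p F.
Proof.
move=> Qpd P0 PQ.
(* One constant compares both the identity and [P] with [Q]. *)
have [a a1 [QI PI]] : exists2 a, 1 <= a &
    (forall i v, sqnorm v <= a * bilin (Q i) v v) /\
    (forall i v, bilin (P i) v v <= a * bilin (Q i) v v).
  have /choice[c cP] (i : 'I_n) : exists c, 0 < c /\
      forall v, sqnorm v <= c * bilin (Q i) v v.
    by have [c c0 cQ] := posdef_coercive (Qpd i); exists c.
  pose b := \sum_i c i.
  have c0 i : 0 < c i by case: (cP i).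
  have b0 : 0 <= b by apply: sumr_ge0 => i _; apply: ltW.
  have bQ i v : sqnorm v <= b * bilin (Q i) v v.
    have [_ /(_ v) /le_trans] := cP i; apply.
    rewrite ler_wpM2r ?posdef_ge0// /b (bigD1 i)//= lerDl.
    by apply: sumr_ge0 => j _; apply: ltW.
  have [C C0 CP] := bilin_bounded P.
  exists (1 + b + (C *+ 2) * b).
    by rewrite -addrA lerDl addr_ge0// mulr_ge0// ltW// mulrn_wgt0.
  split=> i v; have Q0 := posdef_ge0 v (Qpd i).
    rewrite (le_trans (bQ i v))// ler_wpM2r//.
    by rewrite addrAC lerDr addr_ge0// mulr_ge0// ltW// mulrn_wgt0.
  rewrite (le_trans (ler_norm _))// (le_trans (CP i v v))//.
  have -> : C * (sqnorm v + sqnorm v) = C *+ 2 * sqnorm v by ring.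
  rewrite [leRHS]mulrDl -[X in _ <= _ + X]mulrA; apply: ler_wpDl; first by rewrite mulr_ge0// addr_ge0.
  by rewrite ler_wpM2l// ltW// mulrn_wgt0.
have a0 : 0 < a by apply: lt_le_trans a1.
have PQle i v : bilin (Q i) v v <= bilin (P i) v v.
  by rewrite -subr_ge0 (le_trans _ (PQ i v))// mode_step_ge0.
pose r := 1 - a^-1.
have r0 : 0 <= r by rewrite subr_ge0 invf_le1.
have r1 : r < 1 by rewrite ltrBlDr ltrDl invr_gt0.
have decay t : forall i v, bilin (iter t (mode_step p F) (fun=> 1%:M) i) v v
    <= a * r ^+ t * bilin (P i) v v.
  elim: t => [|t IH] i v.
    rewrite /= expr0 mulr1 -sqnormE (le_trans (QI i v))// ler_wpM2l// ltW//.
  rewrite iterS bilin_mode_step.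
  apply: (@le_trans _ _ (a * r ^+ t * bilin (mode_step p F P i) v v)).
    rewrite bilin_mode_step mulr_sumr; apply: ler_sum => j _.
    by rewrite mulrCA ler_wpM2l.
  rewrite exprSr mulrA -[leRHS]mulrA ler_wpM2l//.
    by rewrite mulr_ge0 ?exprn_ge0// ltW.
  rewrite (le_trans (PQ i v))// mulrBl mul1r lerB// mulrC ler_pdivrMr//.
  by rewrite mulrC.
move=> i v; apply: (squeeze_cvgr (f := fun=> 0)
  (h := fun t => a * r ^+ t * bilin (P i) v v)).
- near=> t; rewrite decay andbT.
  elim: {+}t i v => [|s IH] i v; first by rewrite /= -sqnormE sqnorm_ge0.
  exact: mode_step_ge0.
- exact: cvg_cst.
- rewrite -(mul0r (bilin (P i) v v)); apply: cvgM; last exact: cvg_cst.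
  by apply: cvg_geometric; rewrite ger0_norm.
Unshelve. all: by end_near. Qed.

End Positivity.

(** * The coupled Lyapunov equations *)

Lemma linear_inj_surj (K : fieldType) (V : vectType K) (f : {linear V -> V}) :
  injective f -> forall y, exists x, f x = y.
Proof.
move=> f_inj y.
have /lker0_limgf f_full : lker (linfun f) == 0%VS.
  by apply/lker0P => u v; rewrite !lfunE; apply: f_inj.
have : y \in limg (linfun f) by rewrite f_full memvf.
by case/memv_imgP => x _ ->; exists x; rewrite lfunE.
Qed.

(** Indexed by finite functions, which carry the finite-dimensional vector space
    structure that bare functions lack. *)
Definition lyap_op {R : realType} {n d : nat} (p : 'I_n -> 'I_n -> R)
    (F : 'I_n -> 'M[R]_d) (X : {ffun 'I_n -> 'M[R]_d}) :
    {ffun 'I_n -> 'M[R]_d} := [ffun i => X i - mode_step p F X i].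

Lemma lyap_op_is_linear (R : realType) n d (p : 'I_n -> 'I_n -> R)
  (F : 'I_n -> 'M[R]_d) : linear (lyap_op p F).
Proof.
move=> a X Y; apply/ffunP => i; rewrite !ffunE.
have -> : mode_step p F (a *: X + Y) i =
    a *: mode_step p F X i + mode_step p F Y i.
  rewrite -mode_step_linear; congr mode_step.
  by apply/funext => j; rewrite !ffunE.
by rewrite scalerBr opprD addrACA.
Qed.

HB.instance Definition _ (R : realType) n d p F :=
  GRing.isLinear.Build R {ffun 'I_n -> 'M[R]_d} {ffun 'I_n -> 'M[R]_d} _
    (lyap_op p F) (lyap_op_is_linear p F).

(** Stability leaves no nonzero fixed point of [mode_step], so the difference
    between the identity and [mode_step] is an injective endomorphism of a
    finite-dimensional space, hence surjective. *)
Lemma step_stable_solvable (R : realType) n d (p : 'I_n -> 'I_n -> R)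
    (F S : 'I_n -> 'M[R]_d) : (forall i j, 0 <= p i j) -> step_stable p F ->
  exists P, forall i, P i = S i + mode_step p F P i.
Proof.
move=> p0 st; have lyap_inj : injective (lyap_op p F).
  apply: raddf_inj => X /ffunP X0; apply/ffunP => i; rewrite ffunE.
  apply: (step_fixed_eq0 p0 st) => j; apply/eqP.
  by have := X0 j; rewrite !ffunE => /eqP; rewrite subr_eq0.
have [P /ffunP PS] := linear_inj_surj lyap_inj [ffun i => S i].
by exists P => i; have := PS i; rewrite !ffunE => <-; rewrite subrK.
Qed.

Section GaussNewton.
Variables (R : realType) (n d k : nat).
Variables (A : 'I_n -> 'M[R]_d) (B : 'I_n -> 'M[R]_(d, k)).
Variables (Q : 'I_n -> 'M[R]_d) (Rc : 'I_n -> 'M[R]_k).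
Variable p : 'I_n -> 'I_n -> R.
Hypotheses (p0 : forall i j, 0 <= p i j) (Qpd : forall i, posdef (Q i)).
Hypothesis Rpd : forall i, posdef (Rc i).
Implicit Type K : 'I_n -> 'M[R]_(k, d).

Let clo K i := A i - B i *m K i.

Lemma lyap_solP K : step_stable p (clo K) ->
  coupled_lyapunov p A B Q Rc K (lyap_sol p A B Q Rc K).
Proof.
move=> st; apply: (@xgetPex _ _ [set P | coupled_lyapunov p A B Q Rc K P]).
by have [P PS] := step_stable_solvable
  (fun i => Q i + (K i)^T *m Rc i *m K i) p0 st; exists P.
Qed.

Lemma coupled_lyapunov_uniq K P P' : step_stable p (clo K) ->
  coupled_lyapunov p A B Q Rc K P -> coupled_lyapunov p A B Q Rc K P' ->
  forall i, P i = P' i.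
Proof.
move=> st PE PE' i; apply/esym/eqP; rewrite -subr_eq0 -scaleN1r addrC.
apply/eqP; move: i; apply: (step_fixed_eq0 p0 st) => i.
rewrite mode_step_linear {1}(PE i) {1}(PE' i) !scaleN1r opprD addrACA.
by rewrite addNr add0r.
Qed.

Lemma cost_tr K i : (Q i + (K i)^T *m Rc i *m K i)^T =
  Q i + (K i)^T *m Rc i *m K i.
Proof.
rewrite linearD /= !trmx_mul trmxK mulmxA.
by have [-> _] := Qpd i; have [-> _] := Rpd i.
Qed.

(** The transpose of a solution is again a solution, so uniqueness makes the
    solution symmetric. *)
Lemma lyap_sol_tr K i : step_stable p (clo K) ->
  (lyap_sol p A B Q Rc K i)^T = lyap_sol p A B Q Rc K i.
Proof.
move=> st; have PE := lyap_solP st; move: PE; set P := lyap_sol _ _ _ _ _ _.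
move=> PE; apply: (coupled_lyapunov_uniq (P := fun j => (P j)^T) st) => // j.
rewrite [in LHS]PE -[_ *m mode_avg p P j *m _]/(mode_step p (clo K) P j).
by rewrite [LHS]linearD /= cost_tr tr_mode_step.
Qed.

Lemma bilin_lyap K P i v : coupled_lyapunov p A B Q Rc K P ->
  bilin (P i) v v = bilin (Q i) v v + bilin (Rc i) (K i *m v) (K i *m v) +
    bilin (mode_step p (clo K) P i) v v.
Proof. by move=> /(_ i) {1}->; rewrite !bilinD bilin_congr. Qed.

Lemma lyap_sol_ge0 K i v : step_stable p (clo K) ->
  0 <= bilin (lyap_sol p A B Q Rc K i) v v.
Proof.
move=> st; apply: (supersolution_ge0 p0 st) => j u.
rewrite (bilin_lyap j u (lyap_solP st)) lerDr.
by rewrite addr_ge0 ?posdef_ge0.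
Qed.

Lemma gain_hess_posdef K i : step_stable p (clo K) ->
  posdef (gain_hess p A B Q Rc K i).
Proof.
move=> st; have [RT Rpos] := Rpd i; split.
  rewrite /gain_hess linearD /= RT !trmx_mul trmxK mulmxA.
  congr (_ + _ *m _ *m _); rewrite /mode_avg linear_sum; apply: eq_bigr => j _.
  by rewrite linearZ /= lyap_sol_tr.
move=> v v0; rewrite -/(bilin _ v v) bilinD ltr_pwDl//; first exact: Rpos.
rewrite bilin_congr bilin_mode_avg; apply: sumr_ge0 => j _.
by rewrite mulr_ge0// lyap_sol_ge0.
Qed.

(** Completing the square in the gain: with [H] the Hessian and [X] the average
    of [P] over the next mode, the one-step cost of a gain [K - D], as a
    quadratic form in the state, is that of [K] minus
    [(2 (D v)^T G v - (D v)^T H (D v))], where [G = H K - B^T X A].  The update has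
    [G = (2 eta)^-1 H D], which makes the loss [(eta^-1 - 1) (D v)^T H (D v)]. *)
Lemma gauss_newton_cost K eta i v : step_stable p (clo K) -> 0 < eta ->
  let P := lyap_sol p A B Q Rc K in let K' := gauss_newton p A B Q Rc eta K in
  let D := (2 * eta) *:
    (invmx (gain_hess p A B Q Rc K i) *m gain_grad p A B Q Rc K i) in
  bilin (Rc i) (K' i *m v) (K' i *m v) + bilin (mode_step p (clo K') P i) v v =
  bilin (Rc i) (K i *m v) (K i *m v) + bilin (mode_step p (clo K) P i) v v -
  (eta^-1 - 1) * bilin (gain_hess p A B Q Rc K i) (D *m v) (D *m v).
Proof.
move=> st eta0 P K' D; set H := gain_hess p A B Q Rc K i.
have Hpd : posdef H := gain_hess_posdef i st.
set G := gain_grad p A B Q Rc K i in D *.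
have HD : H *m D = (2 * eta) *: G.
  by rewrite /D -scalemxAr mulKVmx// posdef_unit.
have K'E : K' i *m v = K i *m v - D *m v by rewrite /K' /gauss_newton mulmxBl.
set X := mode_avg p P i.
have XT : X^T = X.
  rewrite /X /mode_avg linear_sum; apply: eq_bigr => j _.
  by rewrite linearZ /= lyap_sol_tr.
have [RT _] := Rpd i.
rewrite !bilin_congr -/X.
have -> : clo K i *m v = A i *m v - B i *m (K i *m v).
  by rewrite mulmxBl mulmxA.
have -> : clo K' i *m v = A i *m v - B i *m (K i *m v) + B i *m (D *m v).
  by rewrite mulmxBl -mulmxA K'E mulmxBr opprB addrA addrAC.
rewrite K'E bilin_sqrB// bilin_sqrD//.
set x := A i *m v; set y := K i *m v; set z := x - B i *m y.
set dl := D *m v.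
have Hdl : bilin H dl dl = bilin (Rc i) dl dl + bilin X (B i *m dl) (B i *m dl).
  by rewrite bilinD bilin_congr.
have Gdl : bilin H dl dl =
    2 * eta * (bilin (Rc i) dl y - bilin X (B i *m dl) z).
  transitivity ((dl^T *m (H *m D *m v)) 0 0); first by rewrite /bilin !mulmxA.
  rewrite HD -scalemxAl -scalemxAr mxE; congr (_ * _).
  have -> : G *m v = Rc i *m y - (B i)^T *m X *m z.
    rewrite /G /gain_grad /gain_hess -/P -/X /z mulmxBl mulmxDl mulmxDl.
    by rewrite mulmxBr opprB addrA /x /y !mulmxA.
  by rewrite /bilin !trmx_mul mulmxBr !mulmxA [LHS]mxE; congr (_ + _); rewrite mxE.
have : eta^-1 * bilin H dl dl =
    2 * (bilin (Rc i) dl y - bilin X (B i *m dl) z).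
  by rewrite Gdl; field; rewrite gt_eqF.
rewrite mulrBl => ->; rewrite Hdl; ring.
Qed.

(** The loss in [gauss_newton_cost] is nonnegative as soon as [eta <= 1], and
    then the solution for the old gain is a Lyapunov function for the new one:
    it decreases by at least [Q] at each step. *)
Lemma gauss_newton_step_stable K eta : step_stable p (clo K) ->
  0 < eta -> eta <= 1 -> step_stable p (clo (gauss_newton p A B Q Rc eta K)).
Proof.
move=> st eta0 eta1.
apply: (lyapunov_step_stable p0 Qpd (fun i v => lyap_sol_ge0 i v st)) => i v.
have := gauss_newton_cost i v st eta0.
set P := lyap_sol _ _ _ _ _ _; set K' := gauss_newton _ _ _ _ _ _ _ => /= cost.
have := bilin_lyap i v (lyap_solP st); rewrite -/P => ->.
have R0 := posdef_ge0 (K' i *m v) (Rpd i).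
have eta_loss : 0 <= eta^-1 - 1 by rewrite subr_ge0 invf_ge1.
move: cost; set D := _ *: _ => cost.
have := mulr_ge0 eta_loss (posdef_ge0 (D *m v) (gain_hess_posdef i st)).
by move: cost R0; lra.
Qed.

End GaussNewton.

(** * Second moments along the Markov chain *)

Lemma expectation_finite (R : realType) (d : measure_display)
    (T : measurableType d) (P : probability T R) (I : finType)
    (Y : T -> I) (g : I -> R) :
  (forall y, measurable (Y @^-1` [set y])) ->
  'E_P[fun z => g (Y z)]%E = (\sum_y g y * fine (P (Y @^-1` [set y])))%:E.
Proof.
move=> mY; rewrite unlock.
transitivity (\int[P]_z (\sum_y (g y)%:E * (\1_(Y @^-1` [set y]) z)%:E))%E.
  apply: eq_integral => z _; rewrite (bigD1 (Y z)) //= indicE mem_set// mule1.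
  rewrite big1 ?adde0// => y yY; rewrite indicE memNset ?mule0//= => Yz.
  by rewrite Yz eqxx in yY.
rewrite integral_sum//; last first.
  by move=> y; apply: integrableZl => //; apply: integrable_indic.
rewrite -sumEFin; apply: eq_bigr => y _; rewrite integralZl//; last exact: integrable_indic.
by rewrite integral_indic// setIT EFinM fineK// fin_num_measure.
Qed.

Lemma eq_state (R : realType) n d k (A : 'I_n -> 'M[R]_d)
    (B : 'I_n -> 'M[R]_(d, k)) (K : 'I_n -> 'M[R]_(k, d))
    (w w' : nat -> 'I_n) x0 t :
  (forall s, (s < t)%N -> w s = w' s) ->
  state A B K w x0 t = state A B K w' x0 t.
Proof.
elim: t => //= t IH ww'; rewrite IH => [|s st]; last by rewrite ww'// ltnW.
by rewrite ww'.
Qed.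

Lemma state_closed_loop (R : realType) n d k (A : 'I_n -> 'M[R]_d)
    (B : 'I_n -> 'M[R]_(d, k)) (K : 'I_n -> 'M[R]_(k, d)) w x0 t :
  state A B K w x0 t.+1 = (A (w t) - B (w t) *m K (w t)) *m state A B K w x0 t.
Proof. by rewrite /= mulmxBl mulmxN mulmxA. Qed.

Section SecondMoment.
Variables (R : realType) (n d k : nat).
Variables (A : 'I_n -> 'M[R]_d) (B : 'I_n -> 'M[R]_(d, k)).
Variables (p : 'I_n -> 'I_n -> R) (K : 'I_n -> 'M[R]_(k, d)).
Variables (dT : measure_display) (T : measurableType dT).
Variables (P : probability T R) (w : nat -> T -> 'I_n) (mu : 'I_n -> R).
Hypothesis chain : markov_chain P w mu p.

(* The path up to time [t] as an element of a finite type, so that expectations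
   become finite sums. *)
Let hist t (z : T) : {ffun 'I_t.+1 -> 'I_n} := [ffun s : 'I_t.+1 => w s z].

Let histE t h :
  hist t @^-1` [set h] = [set z | forall s, (s <= t)%N -> w s z = h (inord s)].
Proof.
apply/seteqP; split => z /=.
  by move=> <- s st; rewrite ffunE inordK.
by move=> wh; apply/ffunP => s; rewrite ffunE wh -1?ltnS// inord_val.
Qed.

Let measurable_hist t h : measurable (hist t @^-1` [set h]).
Proof.
have [mw _ _] := chain.
have -> : hist t @^-1` [set h] =
    \bigcap_(s in [set` 'I_t.+1]) (w s @^-1` [set h s]).
  apply/seteqP; split => z /=.
    by move=> <- s _; rewrite /= ffunE.
  by move=> wh; apply/ffunP => s; rewrite ffunE; apply: wh.
apply: fin_bigcap_measurable => // s _; exact: mw.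
Qed.

(** The Markov property: given the history, the next mode may be replaced by its
    conditional average. *)
Lemma expectation_next t (g : {ffun 'I_t.+1 -> 'I_n} -> 'I_n -> R) :
  'E_P[fun z => g (hist t z) (w t.+1 z)]%E =
  'E_P[fun z => (\sum_j p (w t z) j * g (hist t z) j)%R]%E.
Proof.
have [mw _ next] := chain.
pose Y z := (hist t z, w t.+1 z).
have YE h j : Y @^-1` [set (h, j)] =
    hist t @^-1` [set h] `&` w t.+1 @^-1` [set j].
  by apply/seteqP; split => z /= => [[-> ->]|[<- <-]].
have mY y : measurable (Y @^-1` [set y]).
  by case: y => h j; rewrite YE; apply: measurableI.
rewrite (expectation_finite P (fun y => g y.1 y.2) mY).
pose G (h : {ffun 'I_t.+1 -> 'I_n}) := \sum_j p (h ord_max) j * g h j.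
transitivity ('E_P[fun z => G (hist t z)])%E; last first.
  by congr expectation; apply/funext => z; rewrite /G ffunE.
rewrite (expectation_finite P G (@measurable_hist t)); congr EFin.
transitivity (\sum_h \sum_j g h j * fine (P (Y @^-1` [set (h, j)]))).
  by rewrite pair_bigA; apply: eq_bigr => -[].
apply: eq_bigr => h _; rewrite mulr_suml; apply: eq_bigr => j _.
suff -> : fine (P (Y @^-1` [set (h, j)])) =
    fine (P (hist t @^-1` [set h])) * p (h ord_max) j by ring.
rewrite YE histE.
have := next t (fun s => h (inord s)) j.
have -> : inord t = ord_max :> 'I_t.+1 by apply/val_inj; rewrite /= inordK.
by move=> ->; rewrite fineM// fin_num_measure// -histE.
Qed.

(** Conditioning on the history moves one step of the dynamics from the state
    to the form, so the form travels back to time 0. *)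
Lemma expectation_form (X : 'I_n -> 'M[R]_d) x0 t :
  'E_P[fun z => let x := state A B K (fun s => w s z) x0 t in
                bilin (X (w t z)) x x]%E =
  (\sum_i mu i *
     bilin (iter t (mode_step p (fun i => A i - B i *m K i)) X i) x0 x0)%:E.
Proof.
set F := fun i => A i - B i *m K i.
elim: t X => [|t IH] X /=.
  have [mw w0 _] := chain.
  rewrite (expectation_finite P (fun i => bilin (X i) x0 x0) (mw 0%N)).
  congr EFin; apply: eq_bigr => i _.
  by rewrite [P _]w0 mulrC.
rewrite -iterS iterSr -IH.
pose x h := state A B K (fun s => h (inord s : 'I_t.+1)) x0 t.
have xE z : state A B K (fun s => w s z) x0 t = x (hist t z).
  by apply: eq_state => s st; rewrite ffunE inordK// ltnW.
pose g (h : {ffun 'I_t.+1 -> 'I_n}) j :=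
  bilin (X j) (F (h ord_max) *m x h) (F (h ord_max) *m x h).
transitivity ('E_P[fun z => g (hist t z) (w t.+1 z)])%E.
  congr expectation; apply/funext => z.
  have /= -> := state_closed_loop A B K (fun s => w s z) x0 t.
  by rewrite /g -xE ffunE.
rewrite expectation_next; congr expectation; apply/funext => z.
rewrite /= bilin_mode_step; apply: eq_bigr => j _.
by rewrite /g xE ffunE.
Qed.

End SecondMoment.

(** Starting from each single mode extracts the individual summands of the
    expected square norm, so convergence for all initial distributions is
    convergence of each form. *)
Lemma ms_stabilizing_step_stable (R : realType) n d k (A : 'I_n -> 'M[R]_d)
    (B : 'I_n -> 'M[R]_(d, k)) (p : 'I_n -> 'I_n -> R)
    (dT : measure_display) (T : measurableType dT)
    (Pr : ('I_n -> R) -> probability T R) (w : nat -> T -> 'I_n)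
    (K : 'I_n -> 'M[R]_(k, d)) : markov_family Pr w p ->
  ms_stabilizing Pr w A B K <-> step_stable p (fun i => A i - B i *m K i).
Proof.
move=> fam; set F := fun i => A i - B i *m K i.
have ExE mu x0 t : distribution_on mu ->
    'E_(Pr mu)[fun z => sqnorm (state A B K (fun s => w s z) x0 t)]%E =
    (\sum_i mu i * bilin (iter t (mode_step p F) (fun=> 1%:M) i) x0 x0)%:E.
  move=> /fam chain; rewrite -(expectation_form A B K chain).
  by congr expectation; apply/funext => z /=; rewrite sqnormE.
split=> [st i v|st x0 mu mud].
  pose mu j : R := (j == i)%:R.
  have mud : distribution_on mu.
    split=> [j|]; first by rewrite ler0n.
    rewrite (bigD1 i)//= /mu eqxx big1 ?addr0// => j /negPf ->//.
  have := st v mu mud; under eq_fun do rewrite ExE//.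
  move=> /fine_cvgP[_]; set f := fine \o _.
  suff -> : f = fun t => bilin (iter t (mode_step p F) (fun=> 1%:M) i) v v by [].
  apply/funext => t; rewrite /f /=.
  rewrite (bigD1 i)//= /mu eqxx mul1r big1 ?addr0// => j /negPf ->.
  by rewrite mul0r.
under eq_fun do rewrite ExE//.
apply: cvg_EFin; first by near=> t.
rewrite /comp /=.
suff : \sum_i mu i * bilin (iter t (mode_step p F) (fun=> 1%:M) i) x0 x0
    @[t --> \oo] --> \sum_i mu i * 0.
  by rewrite [X in _ --> X -> _]big1// => i _; rewrite mulr0.
apply: (@cvg_big _ _ +%R) => [|i _]; first exact: add_continuous.
apply: cvgM; first exact: cvg_cst.
exact: st.
Unshelve. all: by end_near. Qed.

Theorem lemma3 (R : realType) (n d k : nat)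
  (A : 'I_n -> 'M[R]_d) (B : 'I_n -> 'M[R]_(d, k))
  (Q : 'I_n -> 'M[R]_d) (Rc : 'I_n -> 'M[R]_k)
  (p : 'I_n -> 'I_n -> R)
  (dT : measure_display) (T : measurableType dT)
  (Pr : ('I_n -> R) -> probability T R) (w : nat -> T -> 'I_n)
  (K : 'I_n -> 'M[R]_(k, d)) (eta : R) :
  (forall i, distribution_on (p i)) ->
  (forall i, posdef (Q i)) ->
  (forall i, posdef (Rc i)) ->
  markov_family Pr w p ->
  ms_stabilizing Pr w A B K ->
  0 < eta -> eta <= 2^-1 ->
  ms_stabilizing Pr w A B (gauss_newton p A B Q Rc eta K).
Proof.
move=> pd Qpd Rpd fam /(ms_stabilizing_step_stable _ _ _ fam) st eta0 eta1.
apply/(ms_stabilizing_step_stable _ _ _ fam).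
apply: gauss_newton_step_stable => //; first by move=> i; case: (pd i).
by rewrite (le_trans eta1)// invf_le1 ?ler1n.
Qed.
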